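(* Let $G_1$ be an $r_1$-regular graph with $n_1$ vertices $v_1,\dots,v_{n_1}$ and $m_1$ edges, and let $G_2$ be an arbitrary graph with $n_2\ge 1$ vertices $w_1,\dots,w_{n_2}$. Let $G_1\circ G_2$ be the corona of $G_1$ and $G_2$, with its vertices ordered as $v_1,\dots,v_{n_1}$, followed by $W_1, W_2,\dots,W_{n_2}$, where $W_j=(w^1_j,w^2_j,\dots,w^{n_1}_j)$. Define $$L_1=L(G_1)+n_2I_{n_1},\qquad L_2=-\mathbf{1}^T_{n_2}\otimes I_{n_1},\qquad L_3=(L(G_2)+I_{n_2})\otimes I_{n_1},\qquad S=L_3-J_{n_2\times n_2}\otimes L_1^{-1}.$$ Then, with respect to this vertex ordering, the matrix $$\begin{pmatrix} L_1^{-1}+L_1^{-1}L_2S^{\#}L_2^TL_1^{-1} & -L_1^{-1}L_2S^{\#}\\ -S^{\#}L_2^TL_1^{-1} & S^{\#}\end{pmatrix}$$ is a symmetric $\{1\}$-inverse of the Laplacian matrix $L(G_1\circ G_2)$.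
   Context: All graphs are simple and undirected. For a graph $G$, $A(G)$ is its adjacency matrix, $D(G)$ the diagonal matrix of vertex degrees, and $L(G)=D(G)-A(G)$ its Laplacian matrix. The corona $G_1\circ G_2$ of graphs $G_1$ (on $n_1$ vertices) and $G_2$ (on $n_2$ vertices) is the graph formed from one copy of $G_1$ and $n_1$ copies of $G_2$, where the $i$-th vertex $v_i$ of $G_1$ is joined to every vertex of the $i$-th copy of $G_2$; $w^i_j$ denotes the copy of $w_j$ in the $i$-th copy of $G_2$. $\mathbf{1}_n$ is the all-ones column vector of length $n$, $J_{n\times n}$ the all-ones $n\times n$ matrix, $I_n$ the identity matrix, and $\otimes$ the Kronecker product ($A\otimes B$ is obtained from $A$ by replacing each entry $a_{ij}$ by the block $a_{ij}B$). A matrix $X$ is a $\{1\}$-inverse of $A$ if $AXA=A$. For a square matrix $S$, the group inverse $S^{\#}$ is the unique matrix $X$ with $SXS=S$, $XSX=X$, $SX=XS$ (for real symmetric $S$ it exists and equals the Moore–Penrose inverse). *)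

(* Defs.v *)
From mathcomp Require Import all_boot all_order all_algebra.
From mathcomp Require Import boolp classical_sets ring.
From mathcomp Require Export mxtens.

Set Implicit Arguments.
Unset Strict Implicit.
Unset Printing Implicit Defensive.

Import Order.TTheory GRing.Theory Num.Theory.

Local Open Scope ring_scope.

Record sgraph (V : finType) := SGraph {
  adj :> rel V;
  adj_sym : symmetric adj;
  adj_irr : irreflexive adj }.

Definition degree (V : finType) (G : sgraph V) (x : V) : nat :=
  #|[pred y | G x y]|.

Definition regular (V : finType) (G : sgraph V) (r : nat) : Prop :=
  forall x, degree G x = r.

Definition edges (V : finType) (G : sgraph V) : {set {set V}} :=
  [set [set p.1; p.2]%SET | p in [pred p : V * V | G p.1 p.2]].

(* The matrices of a graph G depend on an ordering v of its vertices, given   *)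
(* as a (bijective) map from positions to vertices; when the vertex set is    *)
(* 'I_n itself, v is the identity.                                            *)
Definition adjmx (R : pzRingType) (V : finType) n (v : 'I_n -> V)
    (G : sgraph V) : 'M[R]_n :=
  \matrix_(i, j) (G (v i) (v j))%:R.

Definition degmx (R : pzRingType) (V : finType) n (v : 'I_n -> V)
    (G : sgraph V) : 'M[R]_n :=
  diag_mx (\row_i (degree G (v i))%:R).

Definition laplacian (R : pzRingType) (V : finType) n (v : 'I_n -> V)
    (G : sgraph V) : 'M[R]_n :=
  degmx R v G - adjmx R v G.

(* inl x is the vertex x of G1; inr (x, y) is the copy of the vertex y of G2  *)
(* in the copy of G2 that is attached to the vertex x of G1.                  *)
Definition corona_adj (V1 V2 : finType) (G1 : sgraph V1) (G2 : sgraph V2) :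
    rel (V1 + V1 * V2) :=
  fun a b => match a, b with
  | inl x, inl x' => G1 x x'
  | inl x, inr (x', _) => x == x'
  | inr (x, _), inl x' => x == x'
  | inr (x, y), inr (x', y') => (x == x') && G2 y y'
  end.

Lemma corona_sym (V1 V2 : finType) (G1 : sgraph V1) (G2 : sgraph V2) :
  symmetric (corona_adj G1 G2).
Proof.
move=> [x|[x y]] [x'|[x' y']] //=; first exact: adj_sym.
by rewrite eq_sym adj_sym.
Qed.

Lemma corona_irr (V1 V2 : finType) (G1 : sgraph V1) (G2 : sgraph V2) :
  irreflexive (corona_adj G1 G2).
Proof. by move=> [x|[x y]] /=; rewrite adj_irr ?andbF. Qed.

Definition corona (V1 V2 : finType) (G1 : sgraph V1) (G2 : sgraph V2) :
    sgraph (V1 + V1 * V2)%type :=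
  SGraph (corona_sym G1 G2) (corona_irr G1 G2).

(* Position i < n1 holds v_i; position n1 + (j * n1 + i) holds w^i_j, i.e.,   *)
(* inr (i, j): the blocks W_j follow each other and each runs over i.         *)
Definition corona_ord (n1 n2 : nat) (k : 'I_(n1 + n2 * n1)) :
    'I_n1 + 'I_n1 * 'I_n2 :=
  match split k with
  | inl i => inl i
  | inr l => inr ((mxtens_unindex l).2, (mxtens_unindex l).1)
  end.

Lemma corona_ord_bij (n1 n2 : nat) : bijective (@corona_ord n1 n2).
Proof.
exists (fun a => match a with
  | inl i => lshift (n2 * n1) i
  | inr (i, j) => rshift n1 (mxtens_index (j, i))
  end).
  move=> k; rewrite /corona_ord; case: (split_ordP k) => [i|l] -> //.
  by rewrite -surjective_pairing mxtens_unindexK.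
move=> [i|[i j]]; rewrite /corona_ord; case: split_ordP => //.
- by move=> i' /lshift_inj ->.
- by move=> l /eqP; rewrite eq_lrshift.
- by move=> i' /eqP; rewrite eq_rlshift.
- by move=> l /rshift_inj <-; rewrite mxtens_indexK.
Qed.

Definition one_inverse (R : pzRingType) m n (A : 'M[R]_(m, n))
    (X : 'M[R]_(n, m)) : Prop :=
  A *m X *m A = A.

Definition is_group_inverse (R : pzRingType) n (S X : 'M[R]_n) : Prop :=
  [/\ S *m X *m S = S, X *m S *m X = X & S *m X = X *m S].

(* The group inverse is defined by unique choice (0 when there is none): see  *)
(* is_group_inverse_uniq for uniqueness, and group_inverseP for existence in  *)
(* the symmetric case.                                                        *)
Definition group_inverse (R : pzRingType) n (S : 'M[R]_n) : 'M[R]_n :=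
  xget 0 (is_group_inverse S : set 'M[R]_n).

Lemma is_group_inverse_uniq (R : pzRingType) n (S X Y : 'M[R]_n) :
  is_group_inverse S X -> is_group_inverse S Y -> X = Y.
Proof.
move=> [SXS XSX SX] [SYS YSY SY].
have SXY : S *m X = S *m Y.
  transitivity (S *m Y *m (S *m X)); first by rewrite mulmxA SYS.
  by rewrite SX SY -mulmxA (mulmxA S X) SXS.
by rewrite -XSX -mulmxA SXY mulmxA -SX SXY SY YSY.
Qed.

Lemma row_sqr_eq0 (R : realFieldType) n (u : 'rV[R]_n) :
  u *m u^T = 0 -> u = 0.
Proof.
move=> /matrixP/(_ 0 0); rewrite !mxE => u0; apply/rowP => i; rewrite mxE.
have ge0 j : true -> 0 <= u 0 j * u^T j 0 by rewrite mxE -expr2 sqr_ge0.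
have /eqP := psumr_eq0P ge0 u0 (erefl true : xpredT i).
by rewrite mxE mulf_eq0 orbb => /eqP.
Qed.

Lemma group_inverseP (R : realFieldType) n (S : 'M[R]_n) :
  S^T = S -> is_group_inverse S (group_inverse S).
Proof.
move=> Ssym; apply: xgetPex.
have rkSS : \rank (S *m S) = \rank S.
  apply/mxrank_injP/eqP/row_matrixP => i; rewrite row0.
  have := row_sub i (S :&: kermx S)%MS.
  rewrite sub_capmx => /andP[/submxP[D uD] /sub_kermxP uS0].
  by apply: row_sqr_eq0; rewrite {2}uD trmx_mul Ssym mulmxA uS0 mul0mx.
have /submxP[D SD] : (S <= S *m S)%MS.
  by rewrite -(geq_leqif (mxrank_leqif_sup (submxMl S S))) rkSS.
have SE : S = S *m S *m D^T by rewrite -{1}Ssym {1}SD !trmx_mul Ssym.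
have DS : D *m S = S *m D^T by rewrite {1}SE mulmxA -SD.
exists (D *m S *m D^T).
have SX : S *m (D *m S *m D^T) = D *m S by rewrite DS !mulmxA -SE -DS.
have XS : D *m S *m D^T *m S = D *m S.
  by rewrite -(mulmxA D) -DS -!mulmxA -SD.
split; rewrite ?SX ?XS //; first by rewrite -mulmxA -SD.
by rewrite mulmxA; congr (_ *m _); rewrite {2}DS -(mulmxA D) (mulmxA S) -SE.
Qed.

Lemma laplacian_addM_unit (R : realFieldType) (n c : nat) (G : sgraph 'I_n) :
  (0 < c)%N -> laplacian R id G + c%:R%:M \in unitmx.
Proof.
move=> c0; rewrite -row_free_unit -kermx_eq0; apply/eqP/row_matrixP => k.
rewrite row0.
have /sub_kermxP := row_sub k (kermx (laplacian R id G + c%:R%:M)).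
move: (row k _) => u.
move=> /(congr1 (mulmx^~ u^T)); rewrite mul0mx => /matrixP/(_ 0 0).
rewrite mulmxDr mul_mx_scalar mulmxDl -scalemxAl !mxE => q0.
pose a i j : R := (G i j)%:R.
have aC i j : a i j = a j i by rewrite /a adj_sym.
have quad : \sum_j (u *m laplacian R id G) 0 j * u^T j 0 =
    2^-1 * \sum_i \sum_j a i j * (u 0 i - u 0 j) ^+ 2.
  have -> : \sum_j (u *m laplacian R id G) 0 j * u^T j 0 =
      \sum_i \sum_j a i j * (u 0 i ^+ 2 - u 0 i * u 0 j).
    rewrite mulmxBr mul_mx_diag; apply: eq_bigr => i _; rewrite !mxE.
    rewrite mulrBl mulrAC -expr2 mulr_suml.
    have -> : (degree G i)%:R = \sum_j a i j.
      by rewrite /degree -sum1_card natr_sum big_mkcond; apply: eq_bigr => j _;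
         rewrite /a inE; case: (G i j).
    rewrite mulr_sumr -sumrB; apply: eq_bigr => j _.
    by rewrite !mxE -/(a j i) (aC j i); ring.
  apply: (mulfI (_ : 2 != 0 :> R)); first by rewrite pnatr_eq0.
  rewrite mulVKf ?pnatr_eq0 // mulrDl !mul1r {2}exchange_big -big_split.
  apply: eq_bigr => i _; rewrite -big_split; apply: eq_bigr => j _ /=.
  rewrite (aC j i) -mulrDr; congr (_ * _).
  by ring.
have ge0 : 0 <= \sum_j (u *m laplacian R id G) 0 j * u^T j 0.
  rewrite quad mulr_ge0 ?invr_ge0 ?ler0n // sumr_ge0 // => i _.
  by apply: sumr_ge0 => j _; rewrite mulr_ge0 ?ler0n ?sqr_ge0.
have uu0 : 0 <= \sum_j u 0 j * u^T j 0.
  by apply: sumr_ge0 => j _; rewrite mxE -expr2 sqr_ge0.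
apply: row_sqr_eq0; apply/matrixP => i j; rewrite !ord1 mxE [RHS]mxE.
move/eqP: q0; rewrite paddr_eq0 // ?mulr_ge0 ?ler0n // => /andP[_].
by rewrite mulf_eq0 pnatr_eq0 eqn0Ngt c0 => /eqP.
Qed.

(* Main.v *)
(* Ordered as in the statement, L(G1 o G2) is the block matrix with blocks L1,
   L2, L2^T, L3, and S is the Schur complement L3 - L2^T L1^-1 L2 of the
   invertible block L1.  Replacing the inverse of the Schur complement by any
   {1}-inverse in the block inversion formula yields a {1}-inverse; symmetry
   of S^# follows from the uniqueness of the group inverse. *)
Require Import Defs.
From mathcomp Require Import all_boot all_order all_algebra.

Set Implicit Arguments.
Unset Strict Implicit.
Unset Printing Implicit Defensive.

Import GRing.Theory.

Local Open Scope ring_scope.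

(** Write [S] for the Schur complement. Whatever [T] is, the product of the two block matrices has
    first block row [(1, 0)]; multiplying again by the first matrix then needs only [S T S = S]. *)
Lemma one_inverse_schur (R : comUnitRingType) m n (A : 'M[R]_m)
    (B : 'M[R]_(m, n)) (C : 'M[R]_(n, m)) (D T : 'M[R]_n) :
  A \in unitmx -> one_inverse (D - C *m invmx A *m B) T ->
  one_inverse (block_mx A B C D)
    (block_mx (invmx A + invmx A *m B *m T *m C *m invmx A)
              (- (invmx A *m B *m T)) (- (T *m C *m invmx A)) T).
Proof.
rewrite /one_inverse => uA; set S := D - _ => STS.
have DE : D = S + C *m invmx A *m B by rewrite subrK.
clearbody S.
have MX : block_mx A B C D *m
    block_mx (invmx A + invmx A *m B *m T *m C *m invmx A)
             (- (invmx A *m B *m T)) (- (T *m C *m invmx A)) T =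
    block_mx 1%:M 0 (C *m invmx A - S *m T *m C *m invmx A) (S *m T).
  rewrite mulmx_block DE; congr block_mx;
    rewrite ?(mulmxDr, mulmxDl, mulmxN) !mulmxA ?mulmxV ?mul1mx ?addrK ?addNr //.
    by rewrite [- _ - _]addrC addrA addrK.
  by rewrite addrC addrK.
rewrite MX mulmx_block !mul1mx !mul0mx !addr0; congr block_mx.
  by rewrite mulmxBl !mulmxKV ?subrK.
(* Lower right block: [S T D] splits into [S T S], which is [S], and [S T C A^-1 B], which
   cancels. *)
by rewrite mulmxBl {1}DE mulmxDr STS !mulmxA addrCA subrK -DE.
Qed.

(** Transposition reverses products, and the three defining equations are stable under this
    reversal. *)
Lemma is_group_inverse_tr (R : comPzRingType) n (S X : 'M[R]_n) :
  is_group_inverse S X -> is_group_inverse S^T X^T.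
Proof.
by case=> SXS XSX SX; split; rewrite -!trmx_mul ?mulmxA ?SXS ?XSX ?SX.
Qed.

Lemma group_inverse_sym (R : realFieldType) n (S : 'M[R]_n) :
  S^T = S -> (group_inverse S)^T = group_inverse S.
Proof.
move=> Ssym; have := is_group_inverse_tr (group_inverseP Ssym).
by rewrite Ssym => /is_group_inverse_uniq; apply; apply: group_inverseP.
Qed.

Lemma laplacian_sym (R : pzRingType) (V : finType) n (v : 'I_n -> V)
    (G : sgraph V) : (laplacian R v G)^T = laplacian R v G.
Proof.
rewrite /laplacian linearB /= tr_diag_mx; congr (_ - _).
by apply/matrixP => i j; rewrite !mxE adj_sym.
Qed.

Lemma card_sum_pred (T1 T2 : finType) (P : pred (T1 + T2)) :
  #|P| = (#|[pred x | P (inl x)]| + #|[pred y | P (inr y)]|)%N.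
Proof.
by rewrite -!sum1_card big_sumType.
Qed.

(** Among the copies of [G2], the neighbours of [inl x] form the whole fibre over [x]. *)
Lemma degree_corona_inl (V1 V2 : finType) (G1 : sgraph V1) (G2 : sgraph V2) x :
  degree (corona G1 G2) (inl x) = (degree G1 x + #|V2|)%N.
Proof.
rewrite /degree card_sum_pred; congr addn.
transitivity #|predX (pred1 x) (@predT V2)|; last by rewrite cardX card1 mul1n.
by apply: eq_card => -[x' y']; rewrite !inE /= eq_sym andbT.
Qed.

(** The extra neighbour is the vertex of [G1] to which the copy is attached. *)
Lemma degree_corona_inr (V1 V2 : finType) (G1 : sgraph V1) (G2 : sgraph V2)
    x y :
  degree (corona G1 G2) (inr (x, y)) = (degree G2 y).+1.
Proof.
rewrite /degree card_sum_pred -add1n; congr addn.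
  by rewrite -(card1 x); apply: eq_card => x'; rewrite !inE /= eq_sym.
transitivity #|predX (pred1 x) [pred y' | G2 y y']|.
  by apply: eq_card => -[x' y']; rewrite !inE /= (eq_sym x).
by rewrite cardX card1 mul1n.
Qed.

Lemma corona_ord_lshift n1 n2 i :
  @corona_ord n1 n2 (lshift (n2 * n1) i) = inl i.
Proof. by rewrite /corona_ord (unsplitK (inl _ i)). Qed.

Lemma corona_ord_rshift n1 n2 j i :
  @corona_ord n1 n2 (rshift n1 (mxtens_index (j, i))) = inr (i, j).
Proof. by rewrite /corona_ord (unsplitK (inr _ _)) mxtens_indexK. Qed.

Lemma laplacianE (R : pzRingType) (V : finType) n (v : 'I_n -> V)
    (G : sgraph V) i j :
  laplacian R v G i j =
  (degree G (v i))%:R *+ (i == j) - (G (v i) (v j))%:R.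
Proof. by rewrite !mxE. Qed.

(** This is [L2]. The Kronecker product has [1 * n1] rows, which the cast identifies with [n1]. *)
Definition corona_offdiag (R : pzRingType) n1 n2 : 'M[R]_(n1, n2 * n1) :=
  castmx (mul1n n1, erefl (n2 * n1)%N)
    (tensmx (- (const_mx 1 : 'cV[R]_n2)^T) (1%:M : 'M[R]_n1)).

Lemma corona_offdiagE (R : pzRingType) n1 n2 i k l :
  corona_offdiag R n1 n2 i (mxtens_index (k, l)) = - (i == l)%:R.
Proof.
rewrite castmxE /= cast_ord_id.
(* The cast keeps values and [0 * n1 + i = i], so the index in the one-row factor is [0]. *)
have -> : cast_ord (esym (mul1n n1)) i = mxtens_index (0, i).
  by apply: val_inj; rewrite /= mul0n.
by rewrite tensmxE !mxE mulN1r.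
Qed.

(** [L2] is a row of [n2] blocks [-I], so the signs cancel and every block of the product is [A].
    For [A = L1^-1] this identifies [S] as the Schur complement. *)
Lemma corona_offdiag_conj (R : pzRingType) n1 n2 (A : 'M[R]_n1) :
  (corona_offdiag R n1 n2)^T *m A *m corona_offdiag R n1 n2 =
  tensmx (const_mx 1 : 'M[R]_n2) A.
Proof.
apply/matrixP => a b.
case: (mxtens_indexP a) => i k; case: (mxtens_indexP b) => j l.
rewrite tensmxE !mxE mul1r (bigD1 l) //= corona_offdiagE eqxx big1 => [|l' nl].
  rewrite !mxE (bigD1 k) //= mxE corona_offdiagE eqxx big1 => [|k' nk].
    by rewrite !addr0 mulrN1 mulNr mul1r opprK.
  by rewrite mxE corona_offdiagE (negPf nk) oppr0 mul0r.
by rewrite corona_offdiagE (negPf nl) oppr0 mulr0.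
Qed.

(** The scalar terms [n2%:R%:M] and [1%:M] record the degrees gained in the corona; the order of the
    [W_j] puts the [G2] factor on the left of the Kronecker product. *)
Lemma laplacian_corona (R : pzRingType) n1 n2 (G1 : sgraph 'I_n1) (G2 : sgraph 'I_n2) :
  laplacian R (@corona_ord n1 n2) (corona G1 G2) =
  block_mx (laplacian R id G1 + n2%:R%:M)
    (corona_offdiag R n1 n2) (corona_offdiag R n1 n2)^T
    (tensmx (laplacian R id G2 + 1%:M) (1%:M : 'M[R]_n1)).
Proof.
apply/matrixP => a b.
case: (split_ordP a) => [i|l] ->; case: (split_ordP b) => [i'|l'] ->;
  rewrite laplacianE ?(block_mxEul, block_mxEur, block_mxEdl, block_mxEdr).
- rewrite !corona_ord_lshift degree_corona_inl card_ord (inj_eq (@lshift_inj _ _)).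
  by rewrite mxE laplacianE mxE natrD mulrnDl addrAC.
- case: (mxtens_indexP l') => j k.
  by rewrite corona_ord_lshift corona_ord_rshift eq_lrshift mulr0n sub0r
     corona_offdiagE.
- case: (mxtens_indexP l) => j k.
  by rewrite corona_ord_lshift corona_ord_rshift eq_rlshift mulr0n sub0r mxE
     corona_offdiagE /= eq_sym.
- case: (mxtens_indexP l) => j k; case: (mxtens_indexP l') => j' k'.
  rewrite !corona_ord_rshift degree_corona_inr tensmxE (inj_eq (@rshift_inj _ _)).
  rewrite (can_eq (@mxtens_indexK _ _)) xpair_eqE mxE laplacianE !mxE /=.
  (* In different copies of [G2] both sides vanish; within one copy the successor in the degree
     gives the [1%:M] term. *)
  case: (k == k'); rewrite ?andbF ?mulr0 ?mulr0n ?subr0 //= andbT mulr1.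
  by rewrite -natr1 mulrnDl addrAC.
Qed.

Theorem theorem3p1 (R : realFieldType) (n1 n2 r1 m1 : nat)
    (G1 : sgraph 'I_n1) (G2 : sgraph 'I_n2) :
  regular G1 r1 -> #|edges G1| = m1 -> (1 <= n2)%N ->
  let L1 : 'M[R]_n1 := laplacian R id G1 + n2%:R%:M in
  let L2 : 'M[R]_(n1, n2 * n1) :=
    castmx (mul1n n1, erefl (n2 * n1)%N)
      (tensmx (- (const_mx 1 : 'cV[R]_n2)^T) (1%:M : 'M[R]_n1)) in
  let L3 : 'M[R]_(n2 * n1) :=
    tensmx (laplacian R id G2 + 1%:M) (1%:M : 'M[R]_n1) in
  let S : 'M[R]_(n2 * n1) :=
    L3 - tensmx (const_mx 1 : 'M[R]_n2) (invmx L1) in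
  let S' := group_inverse S in
  let X : 'M[R]_(n1 + n2 * n1) :=
    block_mx
      (invmx L1 + invmx L1 *m L2 *m S' *m L2^T *m invmx L1)
      (- (invmx L1 *m L2 *m S'))
      (- (S' *m L2^T *m invmx L1))
      S' in
  X^T = X /\ one_inverse (laplacian R (@corona_ord n1 n2) (corona G1 G2)) X.
Proof.
move=> _ _ n2_gt0 L1 L2 L3 S S' X.
(* A Laplacian is positive semidefinite, so adding [n2] times the identity with [n2 >= 1] makes it
   definite. *)
have uL1 : L1 \in unitmx by apply: laplacian_addM_unit.
have L1sym : (invmx L1)^T = invmx L1.
  by rewrite trmx_inv linearD /= laplacian_sym tr_scalar_mx.
have Ssym : S^T = S.
  by rewrite linearB /= !trmx_tens linearD /= laplacian_sym !tr_scalar_mx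
    trmx_const L1sym.
have S'sym : S'^T = S' by apply: group_inverse_sym.
split; last first.
  rewrite laplacian_corona; apply: one_inverse_schur => //.
  by rewrite corona_offdiag_conj; case: (group_inverseP Ssym).
by rewrite /X tr_block_mx linearD !linearN /= !trmx_mul trmxK L1sym S'sym
  !mulmxA.
Qed.
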